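(* Let $A\in\mathbb{R}^{m\times n}$, $B\in\mathbb{R}^{n\times m}$, $b,f\in\mathbb{R}^m$, $c,g\in\mathbb{R}^n$ all be nonzero, and let $\lambda,\mu\in\mathbb{R}$ (possibly zero). Let $k\ge 1$ and suppose that the simultaneous biorthogonal tridiagonal reduction process applied to $(A,B,b,c,f,g)$ does not break down up to index $k+1$. Let $\alpha_i,\theta_i$ ($1\le i\le k$) and $\beta_i,\gamma_i,\delta_i,\eta_i$ ($2\le i\le k+1$) be the scalars it produces, and set $$E_{i,i-1}=\begin{bmatrix}0&\beta_i\\ \delta_i&0\end{bmatrix},\qquad E_{ii}=\begin{bmatrix}\lambda&\alpha_i\\ \theta_i&\mu\end{bmatrix},\qquad E_{i-1,i}=\begin{bmatrix}0&\gamma_i\\ \eta_i&0\end{bmatrix}.$$ Then the block tridiagonal matrix $$H_{k+1,k}=\begin{bmatrix}E_{11}&E_{12}&&\\ E_{21}&E_{22}&\ddots&\\ &\ddots&\ddots&E_{k-1,k}\\ &&E_{k,k-1}&E_{kk}\\ &&&E_{k+1,k}\end{bmatrix}\in\mathbb{R}^{(2k+2)\times 2k}$$ (with $k+1$ block rows and $k$ block columns of $2\times2$ blocks, all blocks not of the form $E_{i,j}$ with $|i-j|\le 1$ being zero) has full column rank.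
   Context: The simultaneous biorthogonal tridiagonal reduction process (in exact arithmetic), with input nonzero $A\in\mathbb{R}^{m\times n}$, $B\in\mathbb{R}^{n\times m}$, $b,f\in\mathbb{R}^m$, $c,g\in\mathbb{R}^n$, is the following. Set $p_0=q_0=0\in\mathbb{R}^m$, $u_0=v_0=0\in\mathbb{R}^n$. Put $\tilde p_1=f$, $\tilde q_1=b$, $\tilde u_1=c$, $\tilde v_1=g$, and $\eta_1p_1=\tilde p_1$, $\beta_1q_1=\tilde q_1$, $\delta_1u_1=\tilde u_1$, $\gamma_1v_1=\tilde v_1$, where the real scalars $\eta_1,\beta_1$ are chosen so that $p_1^\top q_1=1$ and $\delta_1,\gamma_1$ so that $u_1^\top v_1=1$. For $i=1,2,\dots$: - $\alpha_i=p_i^\top A u_i$, $\theta_i=v_i^\top B q_i$; - $\eta_{i+1}p_{i+1}=\tilde p_{i+1}:=B^\top v_i-\delta_i p_{i-1}-\theta_i p_i$; - $\beta_{i+1}q_{i+1}=\tilde q_{i+1}:=A u_i-\gamma_i q_{i-1}-\alpha_i q_i$; - $\delta_{i+1}u_{i+1}=\tilde u_{i+1}:=B q_i-\eta_i u_{i-1}-\theta_i u_i$; - $\gamma_{i+1}v_{i+1}=\tilde v_{i+1}:=A^\top p_i-\beta_i v_{i-1}-\alpha_i v_i$; where the real scalars $\eta_{i+1},\beta_{i+1}$ are chosen so that $p_{i+1}^\top q_{i+1}=1$, and $\delta_{i+1},\gamma_{i+1}$ so that $u_{i+1}^\top v_{i+1}=1$. That is, the scalars are nonzero reals with $\eta_j\beta_j=\tilde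 p_j^\top\tilde q_j$ and $\delta_j\gamma_j=\tilde u_j^\top\tilde v_j$ (for example $\eta_j=|\tilde p_j^\top\tilde q_j|^{1/2}$, $\beta_j=\tilde p_j^\top\tilde q_j/\eta_j$, $\delta_j=|\tilde u_j^\top\tilde v_j|^{1/2}$, $\gamma_j=\tilde u_j^\top\tilde v_j/\delta_j$). The process does not break down up to index $N$ if $\tilde p_j^\top\tilde q_j\neq0$ and $\tilde u_j^\top\tilde v_j\ne0$ for all $1\le j\le N$, so that all vectors with index at most $N$ and the corresponding nonzero scaling scalars are defined. *)

(* Defs.v *)
From mathcomp Require Import all_boot all_order all_algebra.
From mathcomp Require Import reals.

Set Implicit Arguments.
Unset Strict Implicit.
Unset Printing Implicit Defensive.

Import Order.TTheory GRing.Theory Num.Theory.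

Local Open Scope ring_scope.

Definition dotv (R : realType) (d : nat) (x y : 'cV[R]_d) : R :=
  (x^T *m y) 0 0.

(* Sequences are total on [nat]; only the entries constrained by
   [reduction_run] below are meaningful. *)
Record reduction_data (R : realType) (m n : nat) := ReductionData {
  vp : nat -> 'cV[R]_m;
  vq : nat -> 'cV[R]_m;
  vu : nat -> 'cV[R]_n;
  vv : nat -> 'cV[R]_n;
  alpha : nat -> R;
  theta : nat -> R;
  beta : nat -> R;
  gamma : nat -> R;
  delta : nat -> R;
  eta : nat -> R }.

(* The unscaled vectors, indexed from 1; the value at index 0 is junk. *)
Definition tilde_p (R : realType) (m n : nat) (B : 'M[R]_(n, m))
    (f : 'cV[R]_m) (S : reduction_data R m n) (j : nat) : 'cV[R]_m :=
  match j with
  | 0 => 0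
  | 1 => f
  | (i'.+1 as i).+1 =>
      B^T *m vv S i - delta S i *: vp S i' - theta S i *: vp S i
  end.

Definition tilde_q (R : realType) (m n : nat) (A : 'M[R]_(m, n))
    (b : 'cV[R]_m) (S : reduction_data R m n) (j : nat) : 'cV[R]_m :=
  match j with
  | 0 => 0
  | 1 => b
  | (i'.+1 as i).+1 =>
      A *m vu S i - gamma S i *: vq S i' - alpha S i *: vq S i
  end.

Definition tilde_u (R : realType) (m n : nat) (B : 'M[R]_(n, m))
    (c : 'cV[R]_n) (S : reduction_data R m n) (j : nat) : 'cV[R]_n :=
  match j with
  | 0 => 0
  | 1 => c
  | (i'.+1 as i).+1 =>
      B *m vq S i - eta S i *: vu S i' - theta S i *: vu S i
  end.

Definition tilde_v (R : realType) (m n : nat) (A : 'M[R]_(m, n))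
    (g : 'cV[R]_n) (S : reduction_data R m n) (j : nat) : 'cV[R]_n :=
  match j with
  | 0 => 0
  | 1 => g
  | (i'.+1 as i).+1 =>
      A^T *m vp S i - beta S i *: vv S i' - alpha S i *: vv S i
  end.

(* [S] records a run of the process that has produced the vectors of index at
   most [N], i.e. the initialization and the steps [i = 1, ..., N - 1].
   The scaling scalars are any reals achieving the two normalizations; these
   entail [eta j * beta j = dotv (tilde_p j) (tilde_q j)] and
   [delta j * gamma j = dotv (tilde_u j) (tilde_v j)], so the scalars are
   nonzero as soon as [no_breakdown] holds. *)
Definition reduction_run (R : realType) (m n : nat)
    (A : 'M[R]_(m, n)) (B : 'M[R]_(n, m))
    (b : 'cV[R]_m) (c : 'cV[R]_n) (f : 'cV[R]_m) (g : 'cV[R]_n)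
    (N : nat) (S : reduction_data R m n) : Prop :=
  [/\ [/\ vp S 0 = 0, vq S 0 = 0, vu S 0 = 0 & vv S 0 = 0],
      forall i : nat, (1 <= i < N)%N ->
        alpha S i = dotv (vp S i) (A *m vu S i) /\
        theta S i = dotv (vv S i) (B *m vq S i),
      forall j : nat, (1 <= j <= N)%N ->
        [/\ eta S j *: vp S j = tilde_p B f S j,
            beta S j *: vq S j = tilde_q A b S j,
            delta S j *: vu S j = tilde_u B c S j &
            gamma S j *: vv S j = tilde_v A g S j] &
      forall j : nat, (1 <= j <= N)%N ->
        dotv (vp S j) (vq S j) = 1 /\ dotv (vu S j) (vv S j) = 1].

Definition no_breakdown (R : realType) (m n : nat)
    (A : 'M[R]_(m, n)) (B : 'M[R]_(n, m))
    (b : 'cV[R]_m) (c : 'cV[R]_n) (f : 'cV[R]_m) (g : 'cV[R]_n)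
    (N : nat) (S : reduction_data R m n) : Prop :=
  forall j : nat, (1 <= j <= N)%N ->
    dotv (tilde_p B f S j) (tilde_q A b S j) != 0 /\
    dotv (tilde_u B c S j) (tilde_v A g S j) != 0.

Definition mx2 (R : realType) (a11 a12 a21 a22 : R) : 'M[R]_2 :=
  block_mx (a11%:M : 'M_1) (a12%:M : 'M_1) (a21%:M : 'M_1) (a22%:M : 'M_1).

(* Block indices [i], [j] start at 1. *)
Definition Eblock (R : realType) (m n : nat) (S : reduction_data R m n)
    (lambda mu : R) (i j : nat) : 'M[R]_2 :=
  if i == j then mx2 lambda (alpha S i) (theta S i) mu
  else if i == j.+1 then mx2 0 (beta S i) (delta S i) 0
  else if j == i.+1 then mx2 0 (gamma S j) (eta S j) 0
  else 0.

(* [\mxblock] counts blocks from 0, hence the shifts.  The dimensions are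
   literally sums of block sizes, equal to [2 * k + 2] and [2 * k]. *)
Definition Hmx (R : realType) (m n : nat) (S : reduction_data R m n)
    (lambda mu : R) (k : nat) :
    'M[R]_(\sum_(i < k.+1) 2, \sum_(j < k) 2) :=
  \mxblock_(i < k.+1, j < k) Eblock S lambda mu i.+1 j.+1.

(* Main.v *)
Require Import Defs.
From mathcomp Require Import all_boot all_order all_algebra.
From mathcomp Require Import reals.

Set Implicit Arguments.
Unset Strict Implicit.
Unset Printing Implicit Defensive.

Import Order.TTheory GRing.Theory Num.Theory.

Local Open Scope ring_scope.

(** The matrix is block upper Hessenberg with one more block row than block
    columns, and its subdiagonal blocks are antidiagonal with entries [beta]
    and [delta].  Absence of breakdown forces these scalars to be nonzero,
    since [beta *: q] and [delta *: u] are the nonzero unscaled vectors, so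
    the subdiagonal blocks are invertible
    ([no_breakdown_scalars_neq0], [unitmx_antidiag]).  A kernel vector then
    vanishes by back substitution from the last block row upwards: once the
    block components of index greater than [j] are zero, block row [j + 1]
    reads as the subdiagonal block applied to component [j] equals zero
    ([mxrank_block_hessenberg]). *)

Lemma mxrank_block_hessenberg (F : fieldType) (p k : nat)
    (G : nat -> nat -> 'M[F]_p)
    (G0 : forall i j, (j.+1 < i)%N -> G i j = 0)
    (Gunit : forall j, (j < k)%N -> G j.+1 j \in unitmx) :
  \rank (\mxblock_(i < k.+1, j < k) G i j) = (k * p)%N.
Proof.
set H := \mxblock_(i, j) _.
have free : row_free H^T.
  apply: inj_row_free => v vH0.
  have {vH0}Hx0 : H *m v^T = 0 by rewrite -[H]trmxK -trmx_mul vH0 trmx0.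
  apply: (can_inj (@trmxK _ _ _)); rewrite trmx0; move: v^T Hx0 => x /mxcolP Hx0.
  have {}Hx0 (i : 'I_k.+1) : \sum_(j < k) G i j *m submxcol x j = 0.
    have := Hx0 i; rewrite -submxcol_mul submxcol0 /H mxblockEv mxcolK.
    by rewrite -[x in LHS]submxcolK mul_mxrow_mxcol.
  apply/mxcolP => j; rewrite submxcol0; move: j.
  (* Back substitution: induction on the number [d] of trailing block
     components of [x] shown to vanish. *)
  suff x0 d (j : 'I_k) : (k - j <= d)%N -> submxcol x j = 0.
    by move=> j; apply: (x0 k); rewrite leq_subr.
  elim: d j => [|d IHd] j le_kjd.
    by move: le_kjd; rewrite leqn0 subn_eq0 leqNgt ltn_ord.
  (* [lift ord0 j] is the block row of index [j + 1]. *)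
  have := Hx0 (lift ord0 j); rewrite (bigD1 j) //= big1 ?addr0; last first.
    move=> l l_neq_j; have [lt_lj | le_jl] := ltnP l j.
      by rewrite G0 ?mul0mx.
    have lt_jl : (j < l)%N by rewrite ltn_neqAle le_jl eq_sym andbT.
    by rewrite IHd ?mulmx0 // -ltnS (leq_trans _ le_kjd) // ltn_sub2l.
  by move=> /(congr1 (mulmx (invmx (G j.+1 j)))); rewrite mulKmx ?mulmx0 ?Gunit.
by rewrite -mxrank_tr (eqP free) sum_nat_const card_ord.
Qed.

Lemma unitmx_antidiag (R : realType) (x y : R) :
  x != 0 -> y != 0 -> mx2 0 x y 0 \in unitmx.
Proof.
move=> x0 y0.
(* The type ascriptions expose the 2 x 2 block structure. *)
have e : (mx2 0 x y 0 : 'M_(1 + 1)) *m (mx2 0 y^-1 x^-1 0 : 'M_(1 + 1)) = 1%:M.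
  rewrite /mx2 mulmx_block -!scalar_mxM !mulr0 !mul0r !raddf0 !addr0 !add0r.
  by rewrite !divff // -scalar_mx_block.
by case: (mulmx1_unit e).
Qed.

Lemma dotv0l (R : realType) (d : nat) (y : 'cV[R]_d) : dotv 0 y = 0.
Proof. by rewrite /dotv trmx0 mul0mx mxE. Qed.

Lemma dotv0r (R : realType) (d : nat) (x : 'cV[R]_d) : dotv x 0 = 0.
Proof. by rewrite /dotv mulmx0 mxE. Qed.

Lemma no_breakdown_scalars_neq0 (R : realType) (m n : nat)
    (A : 'M[R]_(m, n)) (B : 'M[R]_(n, m))
    (b : 'cV[R]_m) (c : 'cV[R]_n) (f : 'cV[R]_m) (g : 'cV[R]_n)
    (N : nat) (S : reduction_data R m n) :
  reduction_run A B b c f g N S -> no_breakdown A B b c f g N S ->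
  forall j, (1 <= j <= N)%N -> beta S j != 0 /\ delta S j != 0.
Proof.
move=> [_ _ scal _] nobrk j le_jN; have [_ eq_q eq_u _] := scal j le_jN.
have [pq uv] := nobrk j le_jN; split.
  by apply: contra_neq pq => beta0; rewrite -eq_q beta0 scale0r dotv0r.
by apply: contra_neq uv => delta0; rewrite -eq_u delta0 scale0r dotv0l.
Qed.

Theorem proposition4 (R : realType) (m n : nat)
  (A : 'M[R]_(m, n)) (B : 'M[R]_(n, m))
  (b : 'cV[R]_m) (c : 'cV[R]_n) (f : 'cV[R]_m) (g : 'cV[R]_n)
  (lambda mu : R) (k : nat) (S : reduction_data R m n)
  (hA : A != 0) (hB : B != 0) (hb : b != 0) (hc : c != 0)
  (hf : f != 0) (hg : g != 0)
  (hk : (1 <= k)%N)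
  (hrun : reduction_run A B b c f g k.+1 S)
  (hbreak : no_breakdown A B b c f g k.+1 S) :
  \rank (Hmx S lambda mu k) = (2 * k)%N.
Proof.
rewrite mulnC /Hmx.
apply: (mxrank_block_hessenberg
          (G := fun i j => Eblock S lambda mu i.+1 j.+1)).
  move=> i j lt_ji; rewrite /Eblock !eqSS (gtn_eqF (ltnW lt_ji)).
  by rewrite (gtn_eqF lt_ji) ltn_eqF // ltnS 2?ltnW.
move=> j lt_jk.
have [beta_neq0 delta_neq0] :=
  no_breakdown_scalars_neq0 hrun hbreak (j := j.+2) lt_jk.
by rewrite /Eblock !eqSS gtn_eqF // eqxx unitmx_antidiag.
Qed.
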